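(* Let $G=(A\cup B,E)$ be a bipartite graph in which every node has a strict ranking of its neighbors, and let $G^*$ be the auxiliary instance defined below. For every popular max-matching $M$ in $G$ there is a stable matching $S$ in $G^*$ such that $M=S'$.
   Context: Node $u$ prefers matching $M$ to $N$ if $u$ is matched in $M$ and unmatched in $N$, or matched in both and prefers its partner in $M$. $\phi(M,N)$ is the number of nodes preferring $M$ to $N$, $\Delta(M,N)=\phi(M,N)-\phi(N,M)$; a maximum matching $M$ of $G$ is a popular max-matching if $\Delta(M,N)\ge0$ for all maximum matchings $N$. An edge $(u,v)$ blocks a matching if each of $u,v$ is unmatched or prefers the other to its partner; a matching is stable if no edge blocks it. The instance $G^*=(A^*\cup B^*,E^* )$: let $n_0=|A|$. $A^*=\{a_i:a\in A,0\le i\le n_0-1\}$; $B^*=\{\tilde b:b\in B\}\cup\{d_i(a):a\in A,1\le i\le n_0-1\}$ (dummy nodes $d_i(a)$). $E^*$ contains $(a_i,\tilde b)$ for $(a,b)\in E$, $0\le i\le n_0-1$, and $(a_{i-1},d_i(a)),(a_i,d_i(a))$ for $a\in A$, $1\le i\le n_0-1$. If $a$ ranks $b_1\succ\cdots\succ b_k$ in $G$: $a_0$ ranks $\tilde b_1\succ\cdots\succ\tilde b_k\succ d_1(a)$; $a_i$ ($1\le i\le n_0-2$) ranks $d_i(a)\succ\tilde b_1\succ\cdots\succ\tilde b_k\succ d_{i+1}(a)$; $a_{n_0-1}$ ranks $d_{n_0-1}(a)\succ\tilde b_1\succ\cdots\succ\tilde b_k$ (if $n_0=1$, $a_0$ ranks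 $\tilde b_1\succ\cdots\succ\tilde b_k$). $d_i(a)$ ranks $a_{i-1}\succ a_i$. $\tilde b$ ranks all subscript-$(n_0-1)$ neighbors first, then subscript $n_0-2$, ..., subscript $0$ last; within subscript $i$, $\tilde b$ prefers $z_i$ to $z'_i$ iff $b$ prefers $z$ to $z'$ in $G$. For a matching $S$ of $G^*$, $S'\subseteq E$ is obtained by deleting the edges of $S$ incident to dummy nodes and replacing each $(a_i,\tilde b)\in S$ by $(a,b)$. *)

(* Defs.v *)
From HB Require Import structures.
From mathcomp Require Import all_boot all_order all_algebra.
Set Implicit Arguments.
Unset Strict Implicit.
Unset Printing Implicit Defensive.

(* The two sides are separate finite types, so they are disjoint by
   construction.  A strict ranking is a duplicate-free list of the neighbors,
   most preferred first. *)
Record instance (A B : finType) := Instance {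
  edge : A -> B -> bool;
  rankA : A -> seq B;
  rankB : B -> seq A;
  rankA_uniq : forall a, uniq (rankA a);
  rankB_uniq : forall b, uniq (rankB b);
  mem_rankA : forall a b, (b \in rankA a) = edge a b;
  mem_rankB : forall a b, (a \in rankB b) = edge a b
}.

(* Only meaningful when x and y both occur in s. *)
Definition before (T : eqType) (s : seq T) (x y : T) : bool :=
  index x s < index y s.

Section Matchings.
Variables (A B : finType) (G : instance A B).
Implicit Types M N : {set A * B}.

Definition preferA a b b' := before (rankA G a) b b'.
Definition preferB b a a' := before (rankB G b) a a'.

Definition is_matching M : Prop :=
  [/\ forall a b, (a, b) \in M -> edge G a b,
      forall a b b', (a, b) \in M -> (a, b') \in M -> b = b'
    & forall a a' b, (a, b) \in M -> (a', b) \in M -> a = a'].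

Definition matchedA M a : bool := [exists b, (a, b) \in M].
Definition matchedB M b : bool := [exists a, (a, b) \in M].

Definition prefers_matchingA M N a : bool :=
  (matchedA M a && ~~ matchedA N a) ||
  [exists b, exists b', [&& (a, b) \in M, (a, b') \in N & preferA a b b']].
Definition prefers_matchingB M N b : bool :=
  (matchedB M b && ~~ matchedB N b) ||
  [exists a, exists a', [&& (a, b) \in M, (a', b) \in N & preferB b a a']].

Definition phi M N : nat :=
  #|[set a | prefers_matchingA M N a]| + #|[set b | prefers_matchingB M N b]|.

Definition Delta M N : int := ((phi M N)%:Z - (phi N M)%:Z)%R.

Definition is_max_matching M : Prop :=
  is_matching M /\ forall N, is_matching N -> #|N| <= #|M|.

Definition is_popular_max_matching M : Prop :=
  is_max_matching M /\ forall N, is_max_matching N -> (0 <= Delta M N)%R.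

Definition blocks M a b : Prop :=
  [/\ edge G a b,
      ~~ matchedA M a \/ (exists2 b', (a, b') \in M & preferA a b b')
    & ~~ matchedB M b \/ (exists2 a', (a', b) \in M & preferB b a a')].

Definition is_stable_matching M : Prop :=
  is_matching M /\ forall a b, ~ blocks M a b.

End Matchings.

Section Star.
Variables (A B : finType) (G : instance A B).

(* (a, i) is the copy a_i. *)
Definition Astar : finType := (A * 'I_#|A|)%type.

(* inl b is b-tilde.  The dummies of a are d_1(a), .., d_(n0-1)(a), whereas
   ordinals start at 0: inr (a, j) is d_(j+1)(a), adjacent to a_j and a_(j+1). *)
Definition Bstar : finType := (B + A * 'I_#|A|.-1)%type.

Definition star_edge (x : Astar) (y : Bstar) : bool :=
  match y with
  | inl b => edge G x.1 b
  | inr (a, j) => (x.1 == a) && ((x.2 == j :> nat) || (x.2 == j.+1 :> nat))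
  end.

(* The first segment is [:: d_i(a)], empty if i = 0; the last one is
   [:: d_(i+1)(a)], empty if i = n0 - 1. *)
Definition star_rankA (x : Astar) : seq Bstar :=
  let: (a, i) := x in
  [seq inr (a, j) | j : 'I_#|A|.-1 <- enum 'I_#|A|.-1 & j.+1 == i :> nat]
  ++ [seq inl b | b <- rankA G a]
  ++ [seq inr (a, j) | j : 'I_#|A|.-1 <- enum 'I_#|A|.-1 & j == i :> nat].

Lemma dummy_succ_subproof (j : 'I_#|A|.-1) : j.+1 < #|A|.
Proof. by rewrite -ltn_predRL. Qed.

Definition dummy_lo (j : 'I_#|A|.-1) : 'I_#|A| := widen_ord (leq_pred _) j.
Definition dummy_hi (j : 'I_#|A|.-1) : 'I_#|A| :=
  Ordinal (dummy_succ_subproof j).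

Definition star_rankB (y : Bstar) : seq Astar :=
  match y with
  | inl b => [seq (z, i) | i <- rev (enum 'I_#|A|), z <- rankB G b]
  | inr (a, j) => [:: (a, dummy_lo j); (a, dummy_hi j)]
  end.

Lemma star_mem_rankA x y : (y \in star_rankA x) = star_edge x y.
Proof.
case: x => a i; rewrite /star_rankA !mem_cat; case: y => [b|[a' j]] /=.
  rewrite mem_map ?mem_rankA; last by move=> ? ? [].
  by apply/or3P/idP => [[/mapP[]|//|/mapP[]]//|e]; apply: Or32.
apply/or3P/andP => [[/mapP[k]|/mapP[]//|/mapP[k]]|[/eqP<- /orP[]h]].
- by rewrite mem_filter => /andP[/eqP h _] [-> ->]; rewrite eqxx h eqxx orbT.
- by rewrite mem_filter => /andP[/eqP h _] [-> ->]; rewrite eqxx h eqxx.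
- apply: Or33; apply/mapP; exists j => //.
  by rewrite mem_filter mem_enum andbT eq_sym.
- apply: Or31; apply/mapP; exists j => //.
  by rewrite mem_filter mem_enum andbT eq_sym.
Qed.

Lemma star_mem_rankB x y : (x \in star_rankB y) = star_edge x y.
Proof.
case: x => a i; case: y => [b|[a' j]] /=.
  rewrite -(mem_rankB G); apply/allpairsP/idP => [[[k z] /= [_ h [-> _]]]//|h].
  by exists (i, a); rewrite /= mem_rev mem_enum.
by rewrite !inE !xpair_eqE -andb_orr -!val_eqE.
Qed.

Lemma star_rankA_uniq x : uniq (star_rankA x).
Proof.
case: x => a i; rewrite /star_rankA !cat_uniq.
have inj_r : injective (fun j : 'I_#|A|.-1 => inr (a, j) : Bstar)
  by move=> ? ? [].
have inj_l : injective (fun b : B => inl b : Bstar) by move=> ? ? [].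
rewrite !(map_inj_uniq inj_r) (map_inj_uniq inj_l) rankA_uniq.
rewrite !(filter_uniq _ (enum_uniq _)) /= andbT.
apply/andP; split; apply/hasPn => y.
  rewrite mem_cat => /orP[/mapP[b _ ->]|/mapP[j]]; first by apply/mapP => -[].
  rewrite mem_filter => /andP[/eqP h _] ->; rewrite mem_map // mem_filter -h.
  by rewrite -[_ == _ :> nat]/(j.+1 == j) (gtn_eqF (ltnSn j)).
by case/mapP => j _ ->; apply/mapP => -[].
Qed.

Lemma star_rankB_uniq y : uniq (star_rankB y).
Proof.
case: y => [b|[a j]] /=.
  apply: allpairs_uniq; rewrite ?rev_uniq ?enum_uniq ?rankB_uniq //.
  by move=> [i z] [k t] _ _ [-> ->].
by rewrite inE xpair_eqE eqxx -val_eqE /= andbT (ltn_eqF (ltnSn j)).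
Qed.

Definition star : instance Astar Bstar :=
  Instance star_rankA_uniq star_rankB_uniq star_mem_rankA star_mem_rankB.

Definition project (S : {set Astar * Bstar}) : {set A * B} :=
  [set e | [exists i, ((e.1, i), inl e.2) \in S]].

End Star.

(* Main.v *)
Require Import Defs.
From HB Require Import structures.
From mathcomp Require Import all_boot all_order all_algebra.
From mathcomp Require Import zify.

(** A stable matching [S] with [M = S'] is the same as a level [lev a < n0] for
each [a] (the index of the copy carrying the [M]-edge of [a]): stability of the
lifted matching amounts to [lev a = n0 - 1] for unmatched [a] and to the
difference constraints [lev a + w(a, b) <= lev (M b)] for the edges
[(a, b)] outside [M], where [w(a, b)] in [{-1, 0, 1}] is half the sum of the
votes of [a] and [b] for each other against their [M]-partners, and the
right-hand side is [0] when [b] is unmatched. Longest simple paths, started with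
value [n0 - 1] at unmatched nodes and [0] elsewhere, solve these constraints.
The absence of positive cycles and the two boundary conditions come from
popularity: shifting [M] along a cycle, along an alternating path from an
unmatched [a], or along one to an unmatched [b], gives another maximum matching
whose vote balance is twice the weight, up to a single vote of an endpoint. *)

Set Implicit Arguments.
Unset Strict Implicit.
Unset Printing Implicit Defensive.

Import Order.TTheory GRing.Theory Num.Theory.

(** * Longest simple paths in a digraph without positive cycles *)

Section LongestPaths.
Variables (T : finType) (e : rel T) (w : T -> T -> int) (init : T -> int).
Local Open Scope ring_scope.

Fixpoint path_weight (x : T) (q : seq T) : int :=
  if q is y :: q' then w x y + path_weight y q' else 0.

Lemma path_weight_cat x p q :
  path_weight x (p ++ q) = path_weight x p + path_weight (last x p) q.
Proof.
by elim: p x => [|y p IH] x /=; rewrite ?add0r // IH addrA.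
Qed.

Lemma path_weight_rcons x q y :
  path_weight x (rcons q y) = path_weight x q + w (last x q) y.
Proof. by rewrite -cats1 path_weight_cat /= addr0. Qed.

Lemma sum_next (s : T) (q : seq T) : uniq (s :: q) ->
  \sum_(x <- s :: q) w x (next (s :: q) x) = path_weight s q + w (last s q) s.
Proof.
(* The point [y0] to which the last node returns is freed from the head [s], so that the induction
   can drop the head. *)
suff gen y0 : uniq (s :: q) ->
    \sum_(x <- s :: q) w x (next_at x y0 s q) = path_weight s q + w (last s q) y0.
  exact: gen.
elim: q s => [|y q IH] s; first by rewrite big_seq1 /= eqxx add0r.
case/andP=> sq Uq; rewrite big_cons /= eqxx -addrA -(IH y Uq); congr (_ + _).
apply: eq_big_seq => x xq; case: eqP => // xs.
by rewrite -xs xq in sq.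
Qed.

Hypothesis no_positive_cycle : forall s q, uniq (s :: q) -> path e s q ->
  e (last s q) s -> path_weight s q + w (last s q) s <= 0.

Definition is_upath (y : T) (p : seq T) : bool :=
  if p is s :: q then [&& uniq p, path e s q & last s q == y] else false.

Definition start_weight (p : seq T) : int :=
  if p is s :: q then init s + path_weight s q else 0.

(** The potential of [y] is the largest weight of a simple path ending at [y]. Extending a best path
    by an arc gives a simple path or closes a cycle, and cutting that cycle off loses nothing. *)
Lemma longest_path_potential : exists pot : T -> int,
  [/\ forall y, init y <= pot y,
      forall x y, e x y -> pot x + w x y <= pot y
    & forall y, exists s q, [/\ uniq (s :: q), path e s q, last s q = y
                              & pot y = init s + path_weight s q]].
Proof.
have up_size y p : is_upath y p -> (size p <= #|T|)%N.
  by case: p => // s q /and3P[/card_uniqP <- _ _]; exact: max_card.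
have up1 y : is_upath y [:: y] by rewrite /= eqxx.
have [pot potP] : exists pot : T -> int, forall y,
    (exists2 p, is_upath y p & pot y = start_weight p) /\
    forall p, is_upath y p -> start_weight p <= pot y.
  (* Simple paths have at most [#|T|] nodes, and sequences of bounded length form a finite type, so
     a maximum exists. *)
  pose p1 y : {bseq #|T| of T} := Bseq (up_size y _ (up1 y)).
  pose P y (p : {bseq #|T| of T}) := is_upath y p.
  exists (fun y => start_weight [arg max_(p > p1 y | P y p) start_weight p]%O) => y.
  case: arg_maxP => [|p up pmax]; first exact: up1.
  split=> [|p' up']; first by exists p.
  exact: (pmax (Bseq (up_size _ _ up')) up').
exists pot; split.
- move=> y; have [_ pmax] := potP y.
  by have := pmax [:: y]; rewrite /= eqxx addr0; apply.
- move=> x y exy.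
  have [[[//|s q] /and3P[Up Pp /eqP Lp] ->] _] := potP x.
  have [_ ymax] := potP y.
  have [yq|yq] := boolP (y \in s :: q); last first.
    have up : is_upath y (s :: rcons q y).
      rewrite /is_upath -rcons_cons rcons_uniq yq Up /=.
      by rewrite last_rcons rcons_path Pp Lp exy eqxx.
    by have := ymax _ up; rewrite /= path_weight_rcons Lp addrA.
  (* The part of the path up to [y] competes for [pot y]; the rest, with the arc back to [y], is a
     cycle. *)
  have [q1 [q2 [Eq Ly]]] : exists q1 q2, q = q1 ++ q2 /\ last s q1 = y.
    by case/splitPl: yq => q1 q2 <-; exists q1, q2.
  move: Up Pp Lp; rewrite Eq -cat_cons cat_uniq cat_path last_cat Ly.
  case/and3P=> U1 D U2 /andP[P1 P2] L2.
  have Uy : uniq (y :: q2).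
    rewrite /= U2 andbT; apply/negP => yq2; case/hasP: D; exists y => //.
    by rewrite -Ly /= mem_last.
  have cyc := no_positive_cycle Uy P2; rewrite L2 in cyc.
  have := ymax (s :: q1); rewrite /= -/(uniq (s :: q1)) U1 P1 Ly eqxx.
  move=> /(_ isT) /=; have := cyc exy.
  by rewrite path_weight_cat Ly; lia.
- move=> y; have [[[//|s q] /and3P[Up Pp /eqP Lp] ->] _] := potP y.
  by exists s, q.
Qed.

End LongestPaths.

(** * Strict rankings *)

Lemma before_irr (T : eqType) (s : seq T) x : before s x x = false.
Proof. by rewrite /before ltnn. Qed.

Lemma before_total (T : eqType) (s : seq T) x y :
  x \in s -> y \in s -> x != y -> before s x y + before s y x = 1.
Proof.
move=> xs ys xy; rewrite /before.
have : index x s != index y s.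
  by apply: contraNneq xy => /(index_inj x) ->.
by case: ltngtP.
Qed.

Lemma before_pairwise (T : eqType) (r : rel T) (s : seq T) x y :
  pairwise r s -> before s x y -> y \in s -> r x y.
Proof.
move=> /(pairwiseP x) rs lt ys.
have iy : index y s < size s by rewrite index_mem.
have ix := ltn_trans lt iy.
by have := rs _ _ ix iy lt; rewrite !nth_index // -index_mem.
Qed.

Definition better (U : Type) (r : rel U) (o o' : option U) : bool :=
  match o, o' with
  | Some u, Some u' => r u u'
  | Some _, None => true
  | None, _ => false
  end.

(** * Partners and votes *)

Section Partners.
Variables (A B : finType) (G : instance A B).

Definition partnerA (M : {set A * B}) a : option B := [pick b | (a, b) \in M].
Definition partnerB (M : {set A * B}) b : option A := [pick a | (a, b) \in M].

Variable M : {set A * B}.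
Hypothesis matM : is_matching G M.

Lemma mem_partnerA a b : ((a, b) \in M) = (partnerA M a == Some b).
Proof.
have [_ fA _] := matM; rewrite /partnerA; case: pickP => [b' abM|none].
  by apply/idP/eqP => [/(fA _ _ _ abM) ->|[<-]].
by rewrite none.
Qed.

Lemma mem_partnerB a b : ((a, b) \in M) = (partnerB M b == Some a).
Proof.
have [_ _ fB] := matM; rewrite /partnerB; case: pickP => [a' abM|none].
  by apply/idP/eqP => [/(fB _ _ _ abM) ->|[<-]].
by rewrite none.
Qed.

Lemma matchedA_partner a : matchedA M a = isSome (partnerA M a).
Proof.
rewrite /matchedA /partnerA; case: pickP => [b abM|none].
  by apply/existsP; exists b.
by apply/existsP => -[b]; rewrite none.
Qed.

Lemma matchedB_partner b : matchedB M b = isSome (partnerB M b).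
Proof.
rewrite /matchedB /partnerB; case: pickP => [a abM|none].
  by apply/existsP; exists a.
by apply/existsP => -[a]; rewrite none.
Qed.

Lemma card_matching : #|M| = \sum_a isSome (partnerA M a).
Proof.
rewrite -sum1_card big_mkcond /=.
rewrite (eq_bigr (fun e => ((e.1, e.2) \in M) : nat)); last by case.
rewrite -(pair_bigA _ (fun a b => ((a, b) \in M) : nat)) /=.
apply: eq_bigr => a _; case E: (partnerA M a) => [b|] /=.
  rewrite (bigD1 b) //= mem_partnerA E eqxx big1 // => b' bb'.
  by rewrite mem_partnerA E (inj_eq (@Some_inj _)) eq_sym (negPf bb').
by rewrite big1 // => b _; rewrite mem_partnerA E.
Qed.

End Partners.

Section PreferMatching.
Variables (A B : finType) (G : instance A B) (M N : {set A * B}).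
Hypotheses (matM : is_matching G M) (matN : is_matching G N).

Lemma prefers_matchingA_better a : prefers_matchingA G M N a =
  better (preferA G a) (partnerA M a) (partnerA N a).
Proof.
rewrite /prefers_matchingA !matchedA_partner.
apply/orP/idP => [[|/existsP[b /existsP[b' /and3P[]]]]|].
- by case: (partnerA M a) => //; case: (partnerA N a).
- by rewrite (mem_partnerA matM) (mem_partnerA matN) => /eqP-> /eqP->.
- case EM: (partnerA M a) => [b|//]; case EN: (partnerA N a) => [b'|] h; last by left.
  right; apply/existsP; exists b; apply/existsP; exists b'.
  by rewrite (mem_partnerA matM) (mem_partnerA matN) EM EN !eqxx.
Qed.

Lemma prefers_matchingB_better b : prefers_matchingB G M N b =
  better (preferB G b) (partnerB M b) (partnerB N b).
Proof.
rewrite /prefers_matchingB !matchedB_partner.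
apply/orP/idP => [[|/existsP[a /existsP[a' /and3P[]]]]|].
- by case: (partnerB M b) => //; case: (partnerB N b).
- by rewrite (mem_partnerB matM) (mem_partnerB matN) => /eqP-> /eqP->.
- case EM: (partnerB M b) => [a|//]; case EN: (partnerB N b) => [a'|] h; last by left.
  right; apply/existsP; exists a; apply/existsP; exists a'.
  by rewrite (mem_partnerB matM) (mem_partnerB matN) EM EN !eqxx.
Qed.

Lemma phi_better : phi G M N =
  \sum_a better (preferA G a) (partnerA M a) (partnerA N a) +
  \sum_b better (preferB G b) (partnerB M b) (partnerB N b).
Proof.
have card_sum (T : finType) (P : pred T) : #|[set x | P x]| = \sum_x P x.
  by rewrite -sum1dep_card big_mkcond.
rewrite /phi !card_sum; congr (_ + _); apply: eq_bigr => x _.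
  by rewrite prefers_matchingA_better.
by rewrite prefers_matchingB_better.
Qed.

End PreferMatching.

(** * Exchanging mates by a permutation of the nodes *)

Section Exchange.
Variables (A B : finType) (G : instance A B) (M : {set A * B}).
Hypothesis matM : is_matching G M.

(* [inr b] is a placeholder holding [b] when [M] leaves [b] unmatched, so that
   every [b] has exactly one holder in [A + B]. *)
Definition node : finType := (A + B)%type.

Definition mate (x : node) : option B :=
  match x with
  | inl a => partnerA M a
  | inr b => if partnerB M b is None then Some b else None
  end.

Definition holder (b : B) : node :=
  if partnerB M b is Some a then inl a else inr b.

(** A placeholder counts as no partner in the votes of [B]. *)
Definition real (x : node) : option A := if x is inl a then Some a else None.

Lemma mateP x b : (mate x == Some b) = (x == holder b).
Proof.
rewrite /holder; case: x => [a|b'] /=.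
  rewrite -(mem_partnerA matM) (mem_partnerB matM).
  by case: (partnerB M b) => [a'|]; apply/eqP/eqP => // -[->].
have [->|ne] := eqVneq b' b; first by case: (partnerB M b); rewrite ?eqxx.
have neS : (Some b' == Some b) = false by rewrite (inj_eq (@Some_inj _)) (negPf ne).
have neR : (inr b' == inr b :> node) = false by apply/eqP => -[/eqP]; rewrite (negPf ne).
by case: (partnerB M b'); case: (partnerB M b); rewrite ?neS ?neR.
Qed.

Lemma mate_holder b : mate (holder b) = Some b.
Proof. by apply/eqP; rewrite mateP. Qed.

Lemma real_holder b : real (holder b) = partnerB M b.
Proof. by rewrite /holder; case: (partnerB M b). Qed.

(** Votes for letting [x] take over the mate of [y]: possibly one from [x], if it lies in [A], and
    one from the node of [B] that changes hands. *)
Definition gain (x y : node) : nat :=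
  (if x is inl a then better (preferA G a) (mate y) (mate x) : nat else 0) +
  (if mate y is Some b then better (preferB G b) (real x) (real y) : nat else 0).

Definition loss (x y : node) : nat :=
  (if x is inl a then better (preferA G a) (mate x) (mate y) : nat else 0) +
  (if mate y is Some b then better (preferB G b) (real y) (real x) : nat else 0).

Lemma better_irr (U : Type) (r : rel U) o :
  (forall u, r u u = false) -> better r o o = false.
Proof. by case: o => //=. Qed.

Lemma gain_refl x : gain x x = 0.
Proof.
rewrite /gain.
case: x => [a|b]; case: (mate _) => [b'|]; rewrite ?better_irr // => u; exact: before_irr.
Qed.

Lemma loss_refl x : loss x x = 0.
Proof.
rewrite /loss.
case: x => [a|b]; case: (mate _) => [b'|]; rewrite ?better_irr // => u; exact: before_irr.
Qed.

Hypothesis popM : is_popular_max_matching G M.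

Section Permute.
Variables (f g : node -> node).
Hypotheses (fK : cancel f g) (gK : cancel g f).
Hypothesis f_edge : forall a b, mate (f (inl a)) = Some b -> edge G a b.
Hypothesis f_placeholder : forall b, mate (f (inr b)) -> mate (inr b).

(** Each node [x] takes over the mate of [f x]; nodes of [B] that end up at placeholders are
    unmatched. *)
Definition shifted : {set A * B} := [set p | mate (f (inl p.1)) == Some p.2].

Lemma shifted_matching : is_matching G shifted.
Proof.
split=> [a b|a b b'|a a' b]; rewrite !inE /=.
- by move/eqP/f_edge.
- by move=> /eqP-> /eqP[].
- rewrite !mateP => /eqP ab /eqP; rewrite -ab => /(can_inj fK) [].
  by move=> ->.
Qed.

Lemma partnerA_shifted a : partnerA shifted a = mate (f (inl a)).
Proof.
case E: (mate _) => [b|].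
  by apply/eqP; rewrite -(mem_partnerA shifted_matching) inE /= E.
case F: (partnerA _ _) => [b|//].
by move/eqP: F; rewrite -(mem_partnerA shifted_matching) inE /= E.
Qed.

Lemma partnerB_shifted b : partnerB shifted b = real (g (holder b)).
Proof.
have E a : (partnerB shifted b == Some a) = (real (g (holder b)) == Some a).
  rewrite -(mem_partnerB shifted_matching) inE mateP /= -(can_eq gK) fK.
  by rewrite eq_sym; case: (g _).
case F: (real _) => [a|]; first by apply/eqP; rewrite E F.
by case H: (partnerB _ _) => [a|//]; move/eqP: H; rewrite E F.
Qed.

(** After the shift, [b] sits at the node [x] with [f x = holder b], so the votes of [B] can be
    charged to the receiving nodes. *)
Lemma sum_over_nodes (F : B -> node -> nat) :
  \sum_b F b (g (holder b)) =
  \sum_x (if mate (f x) is Some b then F b x else 0).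
Proof.
rewrite [RHS](bigID (fun x => isSome (mate (f x)))) /=.
rewrite [X in _ + X]big1 ?addn0; last by move=> x; case: (mate _).
rewrite (reindex_omap (fun b => g (holder b)) (fun x => mate (f x))) /=.
  apply: eq_big => [b|b _]; first by rewrite gK mate_holder eqxx.
  by rewrite gK mate_holder.
move=> x; case E: (mate _) => [b|//] _ /=; congr Some.
by apply/(can_inj fK); rewrite gK; apply/esym/eqP; rewrite -mateP E.
Qed.

Lemma phi_shifted : phi G shifted M = \sum_x gain x (f x).
Proof.
rewrite (phi_better shifted_matching matM) big_split /=; congr (_ + _).
  rewrite big_sumType /= [X in _ = _ + X]big1 ?addn0 //.
  by apply: eq_bigr => a _; rewrite partnerA_shifted.
rewrite -(sum_over_nodes (fun b x => better (preferB G b) (real x) (real (f x)) : nat)).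
by apply: eq_bigr => b _; rewrite partnerB_shifted gK real_holder.
Qed.

Lemma phi_from_shifted : phi G M shifted = \sum_x loss x (f x).
Proof.
rewrite (phi_better matM shifted_matching) big_split /=; congr (_ + _).
  rewrite big_sumType /= [X in _ = _ + X]big1 ?addn0 //.
  by apply: eq_bigr => a _; rewrite partnerA_shifted.
rewrite -(sum_over_nodes (fun b x => better (preferB G b) (real (f x)) (real x) : nat)).
by apply: eq_bigr => b _; rewrite partnerB_shifted gK real_holder.
Qed.

(** A permutation keeps the total number of mates held, and the placeholders account for the
    unmatched part of [B]. *)
Lemma card_shifted :
  #|shifted| + \sum_b (mate (f (inr b)) : nat) = #|M| + \sum_b (mate (inr b) : nat).
Proof.
rewrite (card_matching shifted_matching) (card_matching matM).
have : \sum_(x : node) (mate (f x) : nat) = \sum_(x : node) (mate x : nat).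
  by rewrite [RHS](reindex f) //; exists g => x _.
rewrite !big_sumType /= => <-; congr (_ + _).
by apply: eq_bigr => a _; rewrite partnerA_shifted.
Qed.

(** By [f_placeholder] no empty placeholder gets filled, so if one were emptied, the shifted
    matching would be larger than [M]. *)
Lemma exchange_placeholder b : mate (inr b) -> mate (f (inr b)).
Proof.
have [[_ maxM] _] := popM.
have le c : (mate (f (inr c)) : nat) <= (mate (inr c) : nat).
  by have /implyP := @f_placeholder c; do 2!case: isSome.
have := maxM _ shifted_matching; have := card_shifted.
rewrite (bigD1 b) //= [in RHS](bigD1 b) //=.
have : \sum_(i | i != b) (mate (f (inr i)) : nat) <= \sum_(i | i != b) (mate (inr i) : nat).
  exact: leq_sum.
move=> /= le_rest eq_sum le_max hb.
by move: eq_sum le_rest le_max; rewrite hb; case: (isSome (mate (f _))) => //=; lia.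
Qed.

(** The placeholders hold no more than before, so [shifted] is again maximum and popularity applies
    to it. *)
Lemma exchange_gain_le : \sum_x gain x (f x) <= \sum_x loss x (f x).
Proof.
have [[_ maxM] pop] := popM.
rewrite -phi_shifted -phi_from_shifted.
suff max_shifted : is_max_matching G shifted.
  by have := pop _ max_shifted; rewrite /Delta; lia.
split=> [|N /maxM]; first exact: shifted_matching.
suff : #|M| <= #|shifted| by lia.
have : \sum_b (mate (f (inr b)) : nat) <= \sum_b (mate (inr b) : nat).
  apply: leq_sum => c _.
  by have /implyP := @f_placeholder c; do 2!case: isSome.
by have := card_shifted; lia.
Qed.

End Permute.

(** * Votes along alternating paths and cycles *)

Definition arc (x y : node) : bool :=
  [&& x != y & if x is inl a then
                 if mate y is Some b then edge G a b else false
               else false].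

Local Open Scope ring_scope.

(** An arc is an edge [(a, b)] outside [M], directed from [a] to the holder of [b]. On arcs this is
    half of gain minus loss, by [arc_gain_loss]. *)
Definition weight (x y : node) : int := (gain x y)%:Z - 1.

Lemma arc_left x y : arc x y -> exists a, x = inl a.
Proof. by case: x => [a|b] /andP[_] //; exists a. Qed.

Lemma arc_mate x y : arc x y -> mate y.
Proof. by case: x => [a|b] /andP[_] //; case: (mate y). Qed.

Lemma better_total (T : eqType) (s : seq T) (u : T) (o : option T) :
  u \in s -> o != Some u -> (forall v, o = Some v -> v \in s) ->
  (better (before s) (Some u) o + better (before s) o (Some u) = 1)%N.
Proof.
move=> us ou os; case: o ou os => [v|//] vu /(_ v erefl) vs /=.
by rewrite before_total //; apply: contraNneq vu => ->.
Qed.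

(** Both ends of an edge outside [M] change partners and rankings are strict, so each end casts
    exactly one vote. *)
Lemma arc_gain_loss x y : arc x y -> (gain x y + loss x y = 2)%N.
Proof.
case: x => [a|c] /andP[xy] //; case E: (mate y) => [b|//] ab.
have yb : y = holder b by apply/eqP; rewrite -mateP E.
have [edgeM _ _] := matM.
rewrite /gain /loss E.
have := @better_total _ (rankA G a) b (mate (inl a)).
rewrite mem_rankA mateP -yb => /(_ ab xy) hA.
have := @better_total _ (rankB G b) a (real y).
rewrite mem_rankB yb real_holder -(mem_partnerB matM) => /(_ ab) hB.
rewrite addnACA; transitivity (1 + 1)%N => //; congr (_ + _)%N.
  by apply: hA => b' /eqP; rewrite mem_rankA -(mem_partnerA matM); exact: edgeM.
apply: hB => [|a' /eqP]; last by rewrite mem_rankB -(mem_partnerB matM); exact: edgeM.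
by rewrite (mem_partnerA matM) -/(mate (inl a)) mateP -yb.
Qed.

Definition vote (x y : node) : int := (gain x y)%:Z - (loss x y)%:Z.

Lemma vote_refl x : vote x x = 0.
Proof. by rewrite /vote gain_refl loss_refl. Qed.

Lemma path_vote s q : path arc s q ->
  path_weight vote s q = path_weight weight s q *+ 2.
Proof.
elim: q s => //= y q IH s /andP[/arc_gain_loss sy /IH ->].
by rewrite /vote /weight; lia.
Qed.

(** Mates are rotated along the path. The return step from the last node to [s] need not be an arc,
    so it enters with its own vote; the last two hypotheses make it admissible. *)
Lemma closed_walk_le s q : uniq (s :: q) -> path arc s q ->
  (forall a b, last s q = inl a -> mate s = Some b -> edge G a b) ->
  (forall b, last s q = inr b -> mate (inr b)) ->
  (forall b, last s q = inr b -> mate s) /\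
  path_weight weight s q *+ 2 + vote (last s q) s <= 0.
Proof.
move=> Us Ps lastA lastB; pose f := next (s :: q).
have fK : cancel f (prev (s :: q)) by exact: prev_next.
have gK : cancel (prev (s :: q)) f by exact: next_prev.
have f_step x : x \in s :: q -> arc x (f x) \/ (x = last s q /\ f x = s).
  (* This relation admits the return step besides the arcs, which turns the path into a cycle. *)
  pose e x y := arc x y || ((x == last s q) && (y == s)).
  have cyc : cycle e (s :: q).
    rewrite /= rcons_path /e !eqxx orbT andbT.
    by apply: sub_path Ps => u v; rewrite /e => ->.
  by case/(next_cycle cyc)/orP => [|/andP[/eqP -> /eqP]]; [left | right].
have f_out x : x \notin s :: q -> f x = x.
  by move=> xq; rewrite /f next_nth (negPf xq).
have f_edge a b : mate (f (inl a)) = Some b -> edge G a b.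
  have [/f_step[|[la ->]]|/f_out ->] := boolP (inl a \in s :: q).
  - by case/andP=> _ + E; rewrite E.
  - exact: lastA.
  - by move/eqP; rewrite -(mem_partnerA matM); case: matM => h _ _; exact: h.
have f_placeholder b : mate (f (inr b)) -> mate (inr b).
  have [/f_step[|[lb _ _]]|/f_out -> //] := boolP (inr b \in s :: q).
    by case/andP.
  exact: lastB.
split=> [b Lb|].
  have := exchange_placeholder fK gK f_edge f_placeholder (lastB _ Lb).
  rewrite -Lb; case/f_step: (mem_last s q) => [|[_ ->] //].
  by rewrite Lb => /andP[].
have : \sum_(x : node) vote x (f x) <= 0.
  rewrite sumrB -!(big_morph Posz PoszD (erefl _)).
  by have := exchange_gain_le fK gK f_edge f_placeholder; lia.
rewrite (bigID (mem (s :: q))) /= [X in _ + X]big1 => [|x /f_out ->]; last exact: vote_refl.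
by rewrite addr0 -big_uniq // sum_next // path_vote.
Qed.

Lemma no_positive_cycle s q : uniq (s :: q) -> path arc s q ->
  arc (last s q) s -> path_weight weight s q + weight (last s q) s <= 0.
Proof.
move=> Us Ps ls; have [a La] := arc_left ls.
case: (@closed_walk_le s q) => //; rewrite ?La //.
  move=> a' b [<-] E; move: ls; rewrite La => /andP[_].
  by rewrite E.
have := arc_gain_loss ls; rewrite /vote /weight La; lia.
Qed.

(** The return step leaves [a'] unmatched and costs at most one vote. Twice the weight is thus at
    most 1, and the weight, an integer, at most 0. *)
Lemma exposed_path_le a (q : seq node) a' : uniq (inl a :: q) -> path arc (inl a) q ->
  last (inl a) q = inl a' -> partnerA M a = None ->
  path_weight weight (inl a) q <= 0.
Proof.
move=> Us Ps La Ea.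
case: (@closed_walk_le (inl a) q) => //; rewrite ?La //; last move=> _.
  by move=> a0 b _; rewrite /= Ea.
have : (loss (inl a') (inl a) <= 1)%N by rewrite /loss /= Ea addn0; case: better.
rewrite /vote; lia.
Qed.

(** If [a] were unmatched, the rotation would match [b] and enlarge [M]. Otherwise the old partner
    of [a] becomes unmatched, again at most one vote, and parity gives the bound. *)
Lemma placeholder_path_le a (q : seq node) b : uniq (inl a :: q) -> path arc (inl a) q ->
  last (inl a) q = inr b -> mate (inl a) /\ path_weight weight (inl a) q <= 0.
Proof.
move=> Us Ps Lb; case: (@closed_walk_le (inl a) q) => //; rewrite ?Lb //.
  move=> _ [<-]; case/lastP: q Ps Lb {Us} => // q y.
  by rewrite last_rcons rcons_path => /andP[_ /arc_mate +] <-.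
move=> /(_ b erefl) ma le0; split=> //.
have : (loss (inr b) (inl a) <= 1)%N by rewrite /loss /=; case: partnerA => //= b'; case: better.
move: le0; rewrite /vote; lia.
Qed.

(** * Existence of levels *)

Lemma path_weight_le s q : path_weight weight s q <= (size q)%:Z.
Proof.
have gain_le x y : (gain x y <= 2)%N.
  by rewrite /gain; case: x => ?; case: (mate y) => *; do ?case: better.
elim: q s => //= y q IH s; have := IH y; have := gain_le s y; rewrite /weight; lia.
Qed.

(** Placeholders have no outgoing arcs, so a path ending in [A] stays in [A]. *)
Lemma path_left_size s q a : uniq (s :: q) -> path arc s q -> last s q = inl a ->
  (size (s :: q) <= #|A|)%N.
Proof.
move=> Us Ps La.
have /card_uniqP <- := Us.
rewrite -(card_codom (@inl_inj A B)).
have inl_all : {subset s :: q <= codom (@inl A B)}.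
  elim: q s Ps La {Us} => [|y q IH] s /=.
    by move=> _ -> x; rewrite inE => /eqP ->; exact: codom_f.
  case/andP=> /arc_left [a' ->] Py Ly x; rewrite inE => /orP[/eqP->|].
    exact: codom_f.
  exact: IH.
exact/subset_leq_card/subsetP.
Qed.

Lemma level_exists : exists lev : A -> nat,
  [/\ forall a, (lev a < #|A|)%N,
      forall a, partnerA M a = None -> lev a = #|A|.-1
    & forall a b, edge G a b -> (a, b) \notin M ->
        (lev a + gain (inl a) (holder b) <=
         (if partnerB M b is Some z then lev z else 0) + 1)%N].
Proof.
pose init (x : node) : int :=
  if x is inl a then if partnerA M a is None then (#|A|.-1)%:Z else 0 else 0.
have [pot [ge_init pot_arc pot_path]] := longest_path_potential init no_positive_cycle.
have init_ge0 x : 0 <= init x.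
  by case: x => //= a; case: partnerA.
(* A matched start has value 0, and at most [#|A|.-1] arcs of weight at most 1 follow; an unmatched
   start already has value [#|A|.-1], and the path adds nothing positive. *)
have pot_le a : pot (inl a) <= (#|A|.-1)%:Z.
  have [s [q [Us Ps La ->]]] := pot_path (inl a).
  have size_q := path_left_size Us Ps La.
  have [a' Es] : exists a', s = inl a'.
    case: q Ps La {Us size_q} => [_ /= ->|y q /andP[/arc_left]] //.
    by exists a.
  have := path_weight_le s q; rewrite Es /= in size_q *.
  case E: (partnerA M a') => [b|]; first by lia.
  move: Us Ps La; rewrite Es => Us Ps La.
  by have := exposed_path_le Us Ps La E; lia.
(* A nontrivial path into a placeholder starts at a matched node, hence with value 0. This yields
   the right-hand side 0 for unmatched [b]. *)
have pot_placeholder b : pot (inr b) <= 0.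
  have [s [q [Us Ps La ->]]] := pot_path (inr b).
  case: q Us Ps La => [|y q] Us Ps La; first by rewrite /= in La *; rewrite La.
  have /andP[/arc_left [a Es] _] := Ps; rewrite {s}Es in Us Ps La *.
  have [ma] := placeholder_path_le Us Ps La.
  by move: ma => /=; case: partnerA => // ? _; rewrite add0r.
have pot_ge0 x : 0 <= pot x by have := ge_init x; have := init_ge0 x; lia.
(* Potentials are nonnegative, so the absolute value only changes the type. *)
exists (fun a => `|pot (inl a)|%N); split.
- move=> a; have A0 : (0 < #|A|)%N by apply/card_gt0P; exists a.
  by have := pot_le a; have := pot_ge0 (inl a); lia.
- move=> a Ea; have := ge_init (inl a); have := pot_le a; rewrite /= Ea; lia.
- move=> a b ab abM.
  have arc_ab : arc (inl a) (holder b).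
    by rewrite /arc mate_holder ab andbT -mateP -(mem_partnerA matM).
  have := pot_arc _ _ arc_ab; have := pot_ge0 (inl a); have := pot_ge0 (holder b).
  rewrite /weight; set w := gain _ _.
  rewrite /holder; case: (partnerB M b) => [z|]; first by lia.
  by have := pot_placeholder b; lia.
Qed.

End Exchange.

(** * Comparisons in concatenated rankings and in [G^*] *)

Section BeforeCat.
Variable T : eqType.
Implicit Types (s : seq T) (x y : T).

Lemma before_cat_left s1 s2 x y :
  before (s1 ++ s2) x y -> y \in s1 -> x \in s1.
Proof.
move=> + ys; rewrite /before !index_cat ys; case: ifP => // _.
by move: ys; rewrite -index_mem; lia.
Qed.

Lemma before_catl s1 s2 x y :
  x \in s1 -> y \in s1 -> before (s1 ++ s2) x y = before s1 x y.
Proof. by move=> xs ys; rewrite /before !index_cat xs ys. Qed.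

Lemma before_catr s1 s2 x y :
  x \notin s1 -> y \notin s1 -> before (s1 ++ s2) x y = before s2 x y.
Proof.
by move=> /negPf xs /negPf ys; rewrite /before !index_cat xs ys ltn_add2l.
Qed.

End BeforeCat.

Lemma before_map (T U : eqType) (h : T -> U) s x y :
  injective h -> before [seq h z | z <- s] (h x) (h y) = before s x y.
Proof. by move=> hI; rewrite /before !index_map. Qed.

(** The list is one copy of [s] for each index in [r], so its order is lexicographic with the index
    first. *)
Lemma before_allpairs (I T : eqType) (r : seq I) (s : seq T) z i z' i' :
  before [seq (u, k) | k <- r, u <- s] (z, i) (z', i') -> z' \in s -> i' \in r ->
  before r i i' \/ i = i' /\ before s z z'.
Proof.
move=> + z's; elim: r => [//|k r IH] lt; rewrite allpairs_cons in lt.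
have pairI l : injective (fun u : T => (u, l) : T * I) by move=> ? ? [].
have memk u l : ((u, l) \in [seq (v, k) | v <- s]) = (u \in s) && (l == k).
  apply/mapP/andP => [[v vs [-> ->]]|[us /eqP->]]; first by rewrite vs eqxx.
  by exists u.
rewrite inE; have [i'k _|i'k /= i'r] := eqVneq i' k.
  have k1 : (z', i') \in [seq (v, k) | v <- s] by rewrite memk z's i'k eqxx.
  have := before_cat_left lt k1; rewrite memk => /andP[zs /eqP ik].
  move: lt; rewrite before_catl ?memk ?zs ?z's ?ik ?i'k ?eqxx //.
  by rewrite before_map //; right.
have [ik|ik] := eqVneq i k.
  by left; rewrite /before /= ik eqxx eq_sym (negPf i'k).
move: lt; rewrite before_catr ?memk ?(negPf ik) ?(negPf i'k) ?andbF // => /IH.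
case/(_ i'r) => [lt|]; last by right.
by left; rewrite /before /= ![k == _]eq_sym (negPf ik) (negPf i'k).
Qed.

Lemma before_rev_enum_ord n (i i' : 'I_n) :
  before (rev (enum 'I_n)) i i' -> i' < i.
Proof.
move=> lt; apply: (before_pairwise (r := fun j j' : 'I_n => j' < j) _ lt).
  rewrite -[pairwise _ _](pairwise_map (@nat_of_ord n) (fun j j' => j' < j)).
  rewrite map_rev val_enum_ord -sorted_pairwise => [|u v w]; last by lia.
  by rewrite rev_sorted iota_ltn_sorted.
by rewrite mem_rev mem_enum.
Qed.

Section Star.
Variables (A B : finType) (G : instance A B).

Lemma star_preferB_real b a i z k : edge G z b ->
  preferB (star G) (inl b) (a, i) (z, k) ->
  k < i \/ i = k /\ preferB G b a z.
Proof.
move=> zb /before_allpairs; rewrite mem_rankB mem_rev mem_enum => /(_ zb isT).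
by case=> [/before_rev_enum_ord|]; [left | right].
Qed.

Lemma star_preferB_dummy a j x :
  ~~ preferB (star G) (inr (a, j)) x (a, dummy_lo j).
Proof. by rewrite /preferB /before /= eqxx. Qed.

Lemma star_preferA_real a i b b' : edge G a b -> edge G a b' ->
  preferA (star G) (a, i) (inl b) (inl b') = preferA G a b b'.
Proof.
move=> ab ab'; have notin c s : (inl c : Bstar A B) \notin [seq inr (a, j) | j <- s].
  by apply/mapP => -[].
have inl_inj : injective (fun c : B => inl c : Bstar A B) by move=> ? ? [].
by rewrite /preferA /= before_catr // before_catl ?mem_map ?mem_rankA // before_map.
Qed.

(** Whatever precedes this dummy would lie in the first block of the ranking, which contains nothing
    else. *)
Lemma star_preferA_first a (i : 'I_#|A|) (j : 'I_#|A|.-1) y :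
  j.+1 = i -> ~~ preferA (star G) (a, i) y (inr (a, j)).
Proof.
move=> ji; apply/negP => lt.
have mem1 : (inr (a, j) : Bstar A B) \in
    [seq inr (a, j) | j : 'I_#|A|.-1 <- enum 'I_#|A|.-1 & j.+1 == i :> nat].
  by apply/mapP; exists j; rewrite // mem_filter ji eqxx mem_enum.
have /mapP[j'] := before_cat_left lt mem1.
rewrite mem_filter => /andP[/eqP j'i _] yE; move: lt; rewrite yE.
have -> : j' = j by apply: val_inj; apply: succn_inj; rewrite ji.
by rewrite /preferA before_irr.
Qed.

Lemma star_preferA_last a (i : 'I_#|A|) (j : 'I_#|A|.-1) b :
  j = i :> nat -> edge G a b -> ~~ preferA (star G) (a, i) (inr (a, j)) (inl b).
Proof.
(* Regrouping puts the real neighbours into the left part, where their predecessors must lie too; a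
   dummy there satisfies [j.+1 = i], not [j = i]. *)
move=> ji ab; apply/negP; rewrite /preferA /= catA => /before_cat_left.
rewrite mem_cat map_f ?mem_rankA ?orbT // => /(_ isT).
rewrite mem_cat => /orP[|/mapP[] //].
by case/mapP=> j'; rewrite mem_filter => /andP[/eqP j'i _] [jj']; have := n_Sn j'; rewrite j'i -ji jj'.
Qed.

(* The level [lev a] is the index of the copy of [a] that carries its
   [M]-edge; lower copies take the dummy above them, higher copies the dummy
   below. *)
Definition lift_matching (M : {set A * B}) (lev : A -> nat) :
    {set Astar A * Bstar A B} :=
  [set e : Astar A * Bstar A B |
    match e.2 with
    | inl b => ((e.1.1, b) \in M) && (e.1.2 == lev e.1.1 :> nat)
    | inr (a, j) =>
        (e.1.1 == a) && (e.1.2 == (if j < lev a then j : nat else j.+1) :> nat)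
    end].

(** * The lifted matching and its stability *)

Section Lift.
Variables (M : {set A * B}) (lev : A -> nat).
Hypotheses (matM : is_matching G M) (lev_lt : forall a, lev a < #|A|).

Lemma mem_lift_real a i b : (((a, i), inl b) \in lift_matching M lev) =
  ((a, b) \in M) && (i == lev a :> nat).
Proof. by rewrite inE. Qed.

Lemma mem_lift_dummy a i a' j : (((a, i), inr (a', j)) \in lift_matching M lev) =
  (a == a') && (i == (if j < lev a' then j : nat else j.+1) :> nat).
Proof. by rewrite inE. Qed.

Lemma project_lift : project (lift_matching M lev) = M.
Proof.
apply/setP => -[a b]; rewrite inE /=; apply/existsP/idP => [[i]|abM].
  by rewrite mem_lift_real => /andP[].
by exists (Ordinal (lev_lt a)); rewrite mem_lift_real abM /=.
Qed.

Lemma lift_is_matching : is_matching (star G) (lift_matching M lev).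
Proof.
have [edgeM fA fB] := matM; split.
- move=> [a i] [b|[a' j]]; rewrite ?mem_lift_real ?mem_lift_dummy /=.
    by case/andP=> /edgeM.
  by case/andP=> -> /eqP ->; case: ifP; rewrite eqxx ?orbT.
- move=> [a i] [b|[a1 j]] [b'|[a2 j']]; rewrite ?mem_lift_real ?mem_lift_dummy.
  + by move=> /andP[abM _] /andP[/(fA _ _ _ abM) ->].
  (* Dummies go to copies strictly below or strictly above [lev a], never to the copy [lev a]
     itself. *)
  + by move=> /andP[_ /eqP il] /andP[/eqP <- /eqP]; case: ifP; lia.
  + by move=> /andP[/eqP <- +] /andP[_ /eqP il] => /eqP; case: ifP; lia.
  + move=> /andP[/eqP <- /eqP h1] /andP[/eqP <- /eqP h2]; congr (inr (_, _)).
    by apply: ord_inj; move: h1 h2; do 2!case: ifP; lia.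
- move=> [a i] [a' i'] [b|[a1 j]]; rewrite ?mem_lift_real ?mem_lift_dummy.
    move=> /andP[abM /eqP i1] /andP[/(fB _ _ _ abM) <- /eqP i2].
    by congr (_, _); apply: val_inj; rewrite /= i1 i2.
  move=> /andP[/eqP -> /eqP i1] /andP[/eqP -> /eqP i2].
  by congr (_, _); apply: val_inj; rewrite /= i1 i2.
Qed.

Hypothesis lev_exposed : forall a, partnerA M a = None -> lev a = #|A|.-1.
Hypothesis lev_edge : forall a b, edge G a b -> (a, b) \notin M ->
  lev a + gain G M (inl a) (holder M b) <=
  (if partnerB M b is Some z then lev z else 0) + 1.

Let S := lift_matching M lev.

(** With [star_preferA_first], copies above the level hold their best choice and so never block. *)
Lemma lift_high_copy a (i : 'I_#|A|) : lev a < i ->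
  exists2 j : 'I_#|A|.-1, j.+1 = i & ((a, i), inr (a, j)) \in S.
Proof.
move=> li; have lt : i.-1 < #|A|.-1 by have := ltn_ord i; lia.
have i_gt0 : 0 < i by lia.
have i_ge : i.-1 < lev a = false by lia.
exists (Ordinal lt); first exact: prednK.
by rewrite mem_lift_dummy eqxx /= i_ge prednK.
Qed.

Lemma lift_partner_wantsA a i y y' : ((a, i), y') \in S ->
  ~~ matchedA S (a, i) \/
    (exists2 y', ((a, i), y') \in S & preferA (star G) (a, i) y y') ->
  preferA (star G) (a, i) y y'.
Proof.
have [_ fA _] := lift_is_matching; move=> ay' [/existsPn/(_ y')|[y1 ay1]].
  by rewrite ay'.
by rewrite (fA _ _ _ ay' ay1).
Qed.

Lemma lift_partner_wantsB x x' y : (x', y) \in S ->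
  ~~ matchedB S y \/
    (exists2 x', (x', y) \in S & preferB (star G) y x x') ->
  preferB (star G) y x x'.
Proof.
have [_ _ fB] := lift_is_matching; move=> xy' [/existsPn/(_ x')|[x1 xy1]].
  by rewrite xy'.
by rewrite (fB _ _ _ xy' xy1).
Qed.

Lemma lift_not_blocked_dummy a i a' j : ~ blocks (star G) S (a, i) (inr (a', j)).
Proof.
have [edgeM _ _] := matM.
case=> /andP[/eqP /= <- adj] wantA wantB.
(* If [j < lev a], the dummy holds the favourite of its two neighbours. *)
have [jl|lj] := ltnP j (lev a).
  have dS : ((a, dummy_lo j), inr (a, j)) \in S by rewrite mem_lift_dummy eqxx jl /=.
  have := lift_partner_wantsB dS wantB; exact/negP/star_preferB_dummy.
(* If [i] differs from [j], it is [j.+1] and the edge itself belongs to [S]. *)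
have [ij|ij] := eqVneq (i : nat) j; last first.
  have iS : ((a, i), inr (a, j)) \in S.
    by rewrite mem_lift_dummy eqxx ltnNge lj /=; move: adj; rewrite (negPf ij).
  by have := lift_partner_wantsA iS wantA; rewrite /preferA before_irr.
have [li|il] := ltnP (lev a) i.
  have [k ki kS] := lift_high_copy li.
  have := lift_partner_wantsA kS wantA; exact/negP/star_preferA_first.
have le : i = lev a :> nat by lia.
(* A matched [a] prefers its real partner to the dummy above; an unmatched [a] has level [#|A|.-1],
   and no dummy lies above that copy. *)
case E: (partnerA M a) => [b|]; last first.
  by have := lev_exposed E; have := ltn_ord j; lia.
have abM : (a, b) \in M by rewrite (mem_partnerA matM) E.
have bS : ((a, i), inl b) \in S by rewrite mem_lift_real abM le /=.
have := lift_partner_wantsA bS wantA; apply/negP/star_preferA_last => //.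
exact: edgeM.
Qed.

Lemma lift_not_blocked_real a i b : ~ blocks (star G) S (a, i) (inl b).
Proof.
have [edgeM _ _] := matM.
case=> /= ab wantA wantB.
have [li|il] := ltnP (lev a) i.
  have [k ki kS] := lift_high_copy li.
  have := lift_partner_wantsA kS wantA; exact/negP/star_preferA_first.
have wantB' z : partnerB M b = Some z ->
    lev z < i \/ i = lev z :> nat /\ preferB G b a z.
  move=> E; have zbM : (z, b) \in M by rewrite (mem_partnerB matM) E.
  have zS : ((z, Ordinal (lev_lt z)), inl b) \in S by rewrite mem_lift_real zbM /=.
  have := lift_partner_wantsB zS wantB.
  by case/(star_preferB_real (edgeM _ _ zbM)) => [|[-> ?]]; [left | right].
have [abM|abM] := boolP ((a, b) \in M).
  have /eqP E : partnerB M b == Some a by rewrite -(mem_partnerB matM).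
  by have := wantB' _ E; rewrite /preferB before_irr => -[|[]] //; lia.
(* The right-hand level, 0 for unmatched [b], is at most [i], and below [i] unless [b] votes for
   [a]; [lev a] is at least [i], and above [i] unless [a] votes for [b]. Every combination violates
   the constraint. *)
have := lev_edge ab abM; rewrite /gain (mate_holder matM) real_holder.
have gA : i = lev a :> nat -> better (preferA G a) (Some b) (mate M (inl a)).
  rewrite /=; case E: (partnerA M a) => [b'|//] le.
  have ab'M : (a, b') \in M by rewrite (mem_partnerA matM) E.
  have bS : ((a, i), inl b') \in S by rewrite mem_lift_real ab'M le /=.
  have := lift_partner_wantsA bS wantA.
  by rewrite star_preferA_real // edgeM.
case E: (partnerB M b) => [z|].
  have [lt|[le gB]] := wantB' _ E.
    by have [ia|ia] := eqVneq (i : nat) (lev a); [rewrite gA // | ]; lia.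
  rewrite [better (preferB G b) _ _]gB.
  by have [ia|ia] := eqVneq (i : nat) (lev a); [rewrite gA // | ]; lia.
rewrite [better (preferB G b) _ _]/=.
by have [ia|ia] := eqVneq (i : nat) (lev a); [rewrite gA // | ]; lia.
Qed.

End Lift.
End Star.

Theorem theorem6 (A B : finType) (G : instance A B) (M : {set A * B}) :
  is_popular_max_matching G M ->
  exists S : {set Astar A * Bstar A B},
    is_stable_matching (star G) S /\ M = project S.
Proof.
move=> popM; have [[matM _] _] := popM.
have [lev [lev_lt lev_exposed lev_edge]] := level_exists matM popM.
exists (lift_matching M lev); split; last by rewrite project_lift.
split; first exact: lift_is_matching.
move=> [a i] [b|[a' j]]; first exact: (lift_not_blocked_real matM lev_lt lev_edge).
exact: (lift_not_blocked_dummy matM lev_exposed).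
Qed.
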